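(* Let $0<c<1/3$. There is a number $N_0=N_0(c)$ such that the following holds for every real $N\ge N_0$. If $S$ is a finite set of (distinct) integers $n>N$ such that \[ \sum_{n\in S}\frac1n\le c\,\frac{\log N\,\log\log\log N}{\log\log N}, \] then $\delta^-(S)>0$.
   Context: For a finite set $S$ of positive integers and a choice of an integer $r(n)$ for each $n\in S$, consider the set of integers that are not in the union of the residue classes $r(n)\pmod n$, $n\in S$. This set is a union of residue classes modulo $\mathrm{lcm}(S)$ and so has an asymptotic density. $\delta^-(S)$ denotes the minimum of this density over all choices of the integers $r(n)$, $n\in S$ (one residue class for each modulus $n\in S$). *)

(* Defs.v *)
From HB Require Import structures.
From mathcomp Require Import all_boot all_order all_algebra.
From mathcomp Require Import finmap.
From mathcomp Require Import all_classical all_reals all_analysis.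

Set Implicit Arguments.
Unset Strict Implicit.
Unset Printing Implicit Defensive.
Import Order.TTheory GRing.Theory Num.Theory.
Import numFieldNormedType.Exports.

Local Open Scope classical_set_scope.
Local Open Scope ring_scope.

Definition count_upto (A : pred int) (X : nat) : nat :=
  (\sum_(1 <= k < X.+1) A k%:Z)%N.

(* [lim] has a junk value on divergent sequences; [cvg_density_periodic] shows
   that the limit exists for every periodic set. *)
Definition density (R : realType) (A : pred int) : R :=
  lim (((count_upto A X)%:R / X%:R : R) @[X --> \oo]).

(* The values of [r] outside [S] are irrelevant. *)
Definition uncovered (S : {fset nat}) (r : nat -> int) : pred int :=
  fun x => all (fun n : nat => (x != r n %[mod n%:Z])%Z) S.

(* An infimum that is attained when all the moduli are positive: see
   [delta_minus_min]. *)
Definition delta_minus (R : realType) (S : {fset nat}) : R :=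
  inf [set density R (uncovered S r) | r in [set: nat -> int]].

Lemma count_uptoS A X : count_upto A X.+1 = (count_upto A X + A X.+1%:Z)%N.
Proof. by rewrite /count_upto big_nat_recr. Qed.

Lemma leq_count_upto A X : (count_upto A X <= X)%N.
Proof.
elim: X => [|X IH]; first by rewrite /count_upto big_geq.
by rewrite count_uptoS -addn1 leq_add// leq_b1.
Qed.

Lemma count_uptoD A (L X : nat) : (forall x, A (x + L%:Z) = A x) ->
  count_upto A (X + L) = (count_upto A X + count_upto A L)%N.
Proof.
move=> AL; elim: X => [|X IH]; first by rewrite /count_upto (@big_geq _ _ _ 1 1).
by rewrite addSn !count_uptoS IH -addSn PoszD AL addnAC.
Qed.

Lemma count_uptoMD A (L q s : nat) : (forall x, A (x + L%:Z) = A x) ->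
  count_upto A (q * L + s) = (q * count_upto A L + count_upto A s)%N.
Proof.
move=> AL; elim: q => [//|q IH].
by rewrite !mulSn -addnA addnC count_uptoD// IH addnC addnA.
Qed.

Lemma cvg_density_periodic (R : realType) A (L : nat) : (0 < L)%N ->
  (forall x, A (x + L%:Z) = A x) ->
  (((count_upto A X)%:R / X%:R : R) @[X --> \oo]) --> ((count_upto A L)%:R / L%:R : R).
Proof.
move=> L0 AL; set C := count_upto A L.
have LR : (0 : R) < L%:R by rewrite ltr0n.
apply/subr_cvg0; apply: norm_cvg0; rewrite -(cvg_shiftS _ _ ) /=.
have h : ((L%:R : R) * harmonic n @[n --> \oo]) --> (0 : R).
  by rewrite -[X in _ --> X](mulr0 L%:R); apply: cvgMr; exact: cvg_harmonic.
apply: (squeeze_cvgr _ (@cvg_cst _ 0 _ _ _) h).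
apply: nearW => n; rewrite normr_ge0 /= /harmonic /=.
have NR : (0 : R) < n.+1%:R by rewrite ltr0n.
set q := (n.+1 %/ L)%N; set s := (n.+1 %% L)%N.
have E : n.+1 = (q * L + s)%N by exact: divn_eq.
have sL : (s < L)%N by rewrite ltn_mod.
have -> : (count_upto A n.+1)%:R / n.+1%:R - C%:R / L%:R =
  ((count_upto A s)%:R - s%:R * (C%:R / L%:R)) / n.+1%:R :> R.
  have CLE : (C%:R / L%:R : R) = n.+1%:R * (C%:R / L%:R) / n.+1%:R.
    by rewrite (mulrC n.+1%:R) mulfK// gt_eqF.
  rewrite {1}CLE -mulrBl; congr (_ / _).
  rewrite {1 2}E count_uptoMD// -/C !natrD !natrM mulrDl.
  by rewrite -[q%:R * L%:R * _]mulrA (mulrCA L%:R) divff ?gt_eqF// mulr1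
    opprD addrACA subrr add0r.
rewrite normrM normfV (gtr0_norm NR) ler_pM2r ?invr_gt0//.
have CL : C%:R / L%:R <= 1 :> R by rewrite ler_pdivrMr// mul1r ler_nat leq_count_upto.
have C0 : 0 <= C%:R / L%:R :> R by rewrite divr_ge0.
have sl : s%:R <= L%:R :> R by rewrite ler_nat ltnW.
have cs : (count_upto A s)%:R <= s%:R :> R by rewrite ler_nat leq_count_upto.
have t1 : s%:R * (C%:R / L%:R) <= s%:R :> R by rewrite ler_piMr.
have t0 : 0 <= s%:R * (C%:R / L%:R) :> R by rewrite mulr_ge0.
rewrite ler_norml; apply/andP; split.
  rewrite lerBrDr addrC; apply: (@le_trans _ _ 0) => //.
  by rewrite subr_le0 (le_trans t1).
by rewrite lerBlDr (le_trans cs)// (le_trans sl)// lerDl.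
Qed.

Lemma uncovered_periodic (S : {fset nat}) (r : nat -> int) (x : int) :
  uncovered S r (x + (\big[lcmn/1%N]_(n <- S) n)%:Z) = uncovered S r x.
Proof.
apply: eq_in_all => n nS; congr (~~ _).
have /dvdnP[k ->] : (n %| \big[lcmn/1%N]_(n <- S) n)%N.
  by rewrite (big_rem n)//= dvdn_lcml.
by rewrite PoszM addrC modzMDl.
Qed.

Lemma density_uncovered (R : realType) (S : {fset nat}) (r : nat -> int) :
  (forall n, n \in S -> (0 < n)%N) ->
  let L := (\big[lcmn/1%N]_(n <- S) n)%N in
  density R (uncovered S r) = (count_upto (uncovered S r) L)%:R / L%:R.
Proof.
move=> S0 L; apply: cvg_lim => //; apply: cvg_density_periodic.
  rewrite /L big_seq; elim/big_ind: _ => // a b a0 b0.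
  by rewrite lcmn_gt0 a0.
exact: uncovered_periodic.
Qed.

Lemma delta_minus_min (R : realType) (S : {fset nat}) :
  (forall n, n \in S -> (0 < n)%N) ->
  (exists r, delta_minus R S = density R (uncovered S r)) /\
  (forall r, delta_minus R S <= density R (uncovered S r)).
Proof.
move=> S0; set L := (\big[lcmn/1%N]_(n <- S) n)%N.
pose C r := count_upto (uncovered S r) L.
have exC : exists n, `[< exists r, C r = n >].
  by exists (C (fun=> 0)); apply/asboolP; exists (fun=> 0).
case: (ex_minnP exC) => m /asboolP[r0 Cr0] mmin.
have min0 r : density R (uncovered S r0) <= density R (uncovered S r).
  rewrite !density_uncovered// ler_wpM2r ?invr_ge0// ler_nat -/L -/(C r0) Cr0.
  by apply: mmin; apply/asboolP; exists r.
have lb : lbound [set density R (uncovered S r) | r in [set: nat -> int]]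
    (density R (uncovered S r0)) by move=> _ [r _ <-].
have le r : delta_minus R S <= density R (uncovered S r).
  by apply: ge_inf; [exists (density R (uncovered S r0))|exists r].
split => //; exists r0; apply/eqP; rewrite eq_le le/=.
by apply: lb_le_inf => //; exists (density R (uncovered S r0)), r0.
Qed.

(* Main.v *)
Require Import Defs.
From HB Require Import structures.
From mathcomp Require Import all_boot all_order all_algebra.
From mathcomp Require Import finmap.
From mathcomp Require Import all_classical all_reals all_analysis.
From mathcomp Require Import ring lra zify.

Set Implicit Arguments.
Unset Strict Implicit.
Unset Printing Implicit Defensive.
Import Order.TTheory GRing.Theory Num.Theory.

Local Open Scope ring_scope.

(** Distortion method (Balister, Bollobas, Morris, Sahasrabudhe, Tiba).
    Expose the residue of a random integer modulo p ^ e, one prime p at a time,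
    in increasing order. The moduli all of whose primes are below a cutoff K
    cover, for the uniform measure, at most the sum of 1/n over the K-smooth
    n >= N, which is small for N large. At each prime p >= K the measure is
    distorted on every fiber so as to charge as little as possible the classes
    whose modulus has largest prime p, keeping the density ratio below
    1 / (1 - delta). Those classes then get mass at most
    E[alpha ^ 2] / (4 delta (1 - delta)), alpha being their proportion in the
    fiber, and E[alpha ^ 2] <= F_p / (p - 1) ^ 2, where F_p, the product of
    1 + (3q - 1) / ((1 - delta) (q - 1) ^ 2) over the primes q < p, bounds the
    second moment of the number of classes of moduli built from primes below p
    that contain the random integer. With delta = 1/10, F_p = O(p ^ (19/20)):
    only 8 residues modulo 30 contain large primes, and 8/30 * 3/(1 - delta) < 1.
    So the sum over p >= K of these masses is small, and some integer is
    uncovered. *)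

(** * Averages over residues and the distortion of one fiber *)

Section Mean.
Context {R : realFieldType}.
Implicit Types (f g : nat -> R) (d : R) (b : nat -> bool).

Definition mean n f : R := (\sum_(x < n) f x) / n%:R.

Lemma mean_le n f g : (forall x, (x < n)%N -> f x <= g x) -> mean n f <= mean n g.
Proof.
by move=> fg; rewrite ler_wpM2r ?invr_ge0// ler_sum// => x _; apply: fg.
Qed.

Lemma eq_mean n f g : (forall x, (x < n)%N -> f x = g x) -> mean n f = mean n g.
Proof. by move=> fg; congr (_ / _); apply: eq_bigr => x _; apply: fg. Qed.

Lemma meanZ n (a : R) f : mean n (fun x => a * f x) = a * mean n f.
Proof. by rewrite /mean -mulr_sumr mulrA. Qed.

Lemma meanD n f g : mean n (fun x => f x + g x) = mean n f + mean n g.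
Proof. by rewrite /mean big_split mulrDl. Qed.

Lemma mean_sum n (I : Type) (s : seq I) (P : pred I) (F : I -> nat -> R) :
  mean n (fun x => \sum_(i <- s | P i) F i x) = \sum_(i <- s | P i) mean n (F i).
Proof. by rewrite /mean exchange_big/= mulr_suml. Qed.

Lemma mean1 n : (0 < n)%N -> mean n (fun=> 1) = 1.
Proof. by move=> n0; rewrite /mean sumr_const card_ord divff// pnatr_eq0 -lt0n. Qed.

(** Each y < M T is x + M t for unique x < M and t < T: x fixes y modulo M and t runs along the
    fiber. When T is coprime to M, the fiber meets every residue modulo T once. *)
Lemma mean_fiber M T f :
  mean (M * T) f = mean M (fun x => mean T (fun t => f (x + M * t)%N)).
Proof.
suff E : \sum_(y < M * T) f y = \sum_(x < M) \sum_(t < T) f (x + M * t)%N.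
  by rewrite /mean E -mulr_suml natrM invfM [M%:R^-1 * _]mulrC mulrA.
rewrite exchange_big/=; elim: T => [|T IH]; first by rewrite muln0 !big_ord0.
rewrite big_ord_recr -IH mulnSr big_split_ord/=; congr (_ + _).
by apply: eq_bigr => x _; rewrite addnC.
Qed.

Definition inclass (x a m : nat) : R := (x == a %[mod m])%:R.

Lemma inclass_ge0 x a m : 0 <= inclass x a m.
Proof. by rewrite ler0n. Qed.

Lemma inclass_le1 x a m : inclass x a m <= 1.
Proof. by rewrite lern1 leq_b1. Qed.

Lemma inclass1 x a : inclass x a 1 = 1.
Proof. by rewrite /inclass !modn1. Qed.

Lemma inclassDr x a m y : (m %| y)%N -> inclass (x + y) a m = inclass x a m.
Proof. by move=> my; rewrite /inclass -modnDmr (eqP my) addn0. Qed.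

Lemma inclassM_le x a m n : inclass x a (m * n) <= inclass x a m * inclass x a n.
Proof.
rewrite /inclass -natrM mulnb ler_nat; case: eqP => //= xa.
have E (d : nat) : (d %| m * n)%N -> x == a %[mod d].
  by move=> dmn; rewrite -(modn_dvdm x dmn) xa modn_dvdm.
by rewrite (E m (dvdn_mulr n (dvdnn m))) (E n (dvdn_mull m (dvdnn n))).
Qed.

Lemma sum_atmost1 (I : finType) (b : pred I) :
  (forall i j, b i -> b j -> i = j) -> (\sum_i b i <= 1)%N.
Proof.
move=> bb; have [i bi|nb] := pickP b.
  rewrite (bigD1 i)//= bi big1// => j ji; case bj: (b j) => //.
  by rewrite (bb _ _ bj bi) eqxx in ji.
by rewrite big1// => i _; rewrite nb.
Qed.

(** Since q is coprime to M, t -> x + M t is injective modulo q, so at most one t out of every q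
    consecutive ones lies in the class; [k] counts the periods. *)
Lemma mean_inclass_le M x a q k : (0 < q)%N -> (0 < k)%N -> coprime q M ->
  mean (q * k) (fun t => inclass (x + M * t) a q) <= q%:R^-1.
Proof.
move=> q0 k0 cop; rewrite mean_fiber.
rewrite (@eq_mean q _ (fun y => inclass (x + M * y) a q)); last first.
  move=> y _; rewrite (@eq_mean k _ (fun=> inclass (x + M * y) a q * 1)).
    by rewrite meanZ mean1// mulr1.
  move=> s _; rewrite mulr1 mulnDr addnA inclassDr//.
  by rewrite mulnCA dvdn_mulr.
rewrite /mean -natr_sum ler_piMl ?invr_ge0// lern1 (sum_atmost1)// => i j.
wlog ij : i j / (i <= j)%N.
  by move=> H; case: (leqP i j) => [/H//|/ltnW/H h] bi bj; rewrite h.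
move=> bi bj; apply/val_inj => /=; move: bj; rewrite -(eqP bi).
rewrite eqn_modDl eqn_mod_dvd ?leq_mul2l ?ij ?orbT// -mulnBr Gauss_dvdr//.
have jq := ltn_ord j.
by rewrite /dvdn modn_small; [rewrite subn_eq0 => ji; lia|lia].
Qed.

(* When the bad set b has proportion a < d in the fiber it gets mass 0; otherwise
   it gets (a - d) / (1 - d). *)
Definition distort T (b : nat -> bool) (d : R) (t : nat) : R :=
  let a := mean T (fun t => (b t)%:R) in
  if a < d then (1 - (b t)%:R) / (1 - a) else (1 - d / a * (b t)%:R) / (1 - d).

Lemma distort_ge0 T b d t : 0 < d < 1 -> 0 <= distort T b d t.
Proof.
move=> /andP[d0 d1]; rewrite /distort; move: (mean _ _) => a.
case: ltP => ad; apply: divr_ge0; try lra; first by case: (b t) => /=; lra.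
have a0 : 0 < a by lra.
by rewrite subr_ge0 mulr_ile1 ?lern1 ?leq_b1// ?divr_ge0 ?ler_pdivrMr ?mul1r//; lra.
Qed.

Lemma distort_le T b d t : 0 < d < 1 -> distort T b d t <= (1 - d)^-1.
Proof.
move=> /andP[d0 d1]; rewrite /distort; move: (mean _ _) => a.
case: ltP => ad; last first.
  have a0 : 0 < a by lra.
  by rewrite ler_piMl ?gerBl ?mulr_ge0 ?invr_ge0//; lra.
apply: (@le_trans _ _ (1 - a)^-1); last by rewrite lef_pV2 ?posrE; lra.
by rewrite ler_piMl ?invr_ge0 ?gerBl//; lra.
Qed.

Lemma mean_distort T b d : (0 < T)%N -> 0 < d < 1 -> mean T (distort T b d) = 1.
Proof.
move=> T0 /andP[d0 d1].
set a := mean T (fun t => (b t)%:R).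
have E (c e : R) : mean T (fun t => c * (1 + e * (b t)%:R)) = c * (1 + e * a).
  by rewrite meanZ meanD mean1// meanZ -/a.
rewrite /distort -/a; clearbody a; case: ltP => ad.
  rewrite (eq_mean (g := fun t => (1 - a)^-1 * (1 + -1 * (b t)%:R))).
    by rewrite E mulN1r mulVf//; lra.
  by move=> t _; rewrite mulN1r mulrC.
have a0 : 0 < a by lra.
rewrite (eq_mean (g := fun t => (1 - d)^-1 * (1 + (- (d / a)) * (b t)%:R))).
  by rewrite E; field; lra.
by move=> t _; rewrite mulNr mulrC.
Qed.

(** For a >= d the bad mass is (a - d) / (1 - d), and 4 d (a - d) <= a ^ 2 because (a - 2 d) ^ 2 >=
    0. *)
Lemma mean_distort_bad T b d (a := mean T (fun t => (b t)%:R)) :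
  0 < d < 1 -> mean T (fun t => distort T b d t * (b t)%:R) <= a ^+ 2 / (4 * d * (1 - d)).
Proof.
move=> /andP[d0 d1]; have dd : 0 < 4 * d * (1 - d) by rewrite !mulr_gt0; lra.
rewrite /distort -/a; case: ltP => ad.
  rewrite (eq_mean (g := fun t => 0 * 1)).
    by rewrite meanZ mul0r divr_ge0 ?sqr_ge0 ?ltW.
  by move=> t _; case: (b t); rewrite ?mulr0 ?mul0r// subrr !mul0r.
have a0 : 0 < a by lra.
rewrite (eq_mean (g := fun t => (1 - d / a) / (1 - d) * (b t)%:R)).
  rewrite meanZ -/a ler_pdivlMr//.
  have -> : (1 - d / a) / (1 - d) * a * (4 * d * (1 - d)) = 4 * d * (a - d).
    by field; lra.
  by have := sqr_ge0 (a - 2 * d); lra.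
by move=> t _; case: (b t); rewrite ?mulr0 ?mulr1.
Qed.

End Mean.

(** * Adjoining a prime to a list of moduli *)

Definition extend (p e : nat) (D : seq nat) : seq nat :=
  [seq (m * p ^ a)%N | a <- iota 0 e.+1, m <- D].

(** Exponents start at 1: when [D] is built from primes below p, these are the moduli of largest
    prime p, whose classes are charged when p is exposed. *)
Definition fresh (p e : nat) (D : seq nat) : seq nat :=
  [seq (m * p ^ a)%N | a <- iota 1 e, m <- D].

Lemma extend_cat p e D : extend p e D = D ++ fresh p e D.
Proof.
rewrite /extend /=; congr (_ ++ _).
by rewrite -[RHS]map_id; apply: eq_map => m; rewrite muln1.
Qed.

Definition covered (S : pred nat) (r : nat -> nat) (D : seq nat) (x : nat) : bool :=
  has (fun n => S n && (x == r n %[mod n])) D.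

(** * Second moments of the number of classes hit, along fibers of a prime power *)

Section SecondMoment.
Context {R : realFieldType}.
Implicit Types (D : seq nat) (r : nat -> nat) (c : R).

(** Counts one class for every modulus in [D], in [S] or not, so that the moment bounds do not
    depend on [S]. *)
Definition hits D r (x : nat) : R := \sum_(m <- D) inclass x (r m) m.

Lemma hits_ge0 D r x : 0 <= hits D r x.
Proof. by apply: sumr_ge0 => m _; apply: inclass_ge0. Qed.

(* Bounds the mean over a fiber of a class modulo p ^ a meeting a class modulo
   p ^ b; for a = b = 0 no loss of c is allowed, since the distorted density h
   has mean 1 there. *)
Definition pair_weight c (p a b : nat) : R :=
  if (a == 0%N) && (b == 0%N) then 1 else c / (p ^ maxn a b)%:R.

Variables (p e M : nat).
Hypotheses (p_pr : prime p) (copM : coprime p M).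
Let T := (p ^ e)%N.

Lemma mean_inclass_pow_le a x u : (a <= e)%N ->
  mean T (fun t => inclass (x + M * t) u (p ^ a)) <= (p ^ a)%:R^-1 :> R.
Proof.
move=> ae; have -> : T = (p ^ a * p ^ (e - a))%N by rewrite -expnD subnKC.
by apply: mean_inclass_le; rewrite ?expn_gt0 ?prime_gt0// coprimeXl.
Qed.

(** Two classes modulo powers of p meet inside a single class modulo the larger power; that class
    has proportion at most p ^ -(max a b), and h <= c costs a factor c. *)
Lemma mean_pair_le c (h : nat -> R) a b x u v :
  (forall t, 0 <= h t <= c) -> mean T h = 1 -> (a <= e)%N -> (b <= e)%N ->
  mean T (fun t => h t * (inclass (x + M * t) u (p ^ a) *
                          inclass (x + M * t) v (p ^ b))) <= pair_weight c p a b.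
Proof.
move=> hc h1 ae be; rewrite /pair_weight.
have c0 : 0 <= c by have /andP[h0 /(le_trans h0)] := hc 0%N.
case: ifPn => [/andP[/eqP-> /eqP->]|_].
  rewrite -h1 le_eqVlt; apply/orP; left; apply/eqP/eq_mean => t _.
  by rewrite !inclass1 !mulr1.
have [n [w [ne -> H]]] : exists n w, [/\ (n <= e)%N, maxn a b = n &
    forall y, inclass y u (p ^ a) * inclass y v (p ^ b) <= inclass y w (p ^ n) :> R].
  have [ab|ba] := leqP a b.
    by exists b, v; split=> // y; rewrite ler_piMl ?inclass_ge0 ?inclass_le1.
  by exists a, u; split=> // y; rewrite ler_piMr ?inclass_ge0 ?inclass_le1.
apply: (@le_trans _ _ (mean T (fun t => c * inclass (x + M * t) w (p ^ n)))).
  apply: mean_le => t _; have /andP[h0 hle] := hc t.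
  by apply: ler_pM; rewrite ?mulr_ge0 ?inclass_ge0.
by rewrite meanZ ler_wpM2l// mean_inclass_pow_le.
Qed.

Lemma hits_extend_le D r x t : (forall m, m \in D -> (m %| M)%N) ->
  hits (extend p e D) r (x + M * t) <=
  \sum_(a <- iota 0 e.+1) \sum_(m <- D)
     inclass x (r (m * p ^ a)%N) m * inclass (x + M * t) (r (m * p ^ a)%N) (p ^ a).
Proof.
move=> DM; rewrite /hits big_allpairs_dep; apply: ler_sum => a _.
rewrite big_seq [leRHS]big_seq; apply: ler_sum => m mD.
rewrite (le_trans (inclassM_le _ _ _ _))// inclassDr//.
by rewrite dvdn_mulr// DM.
Qed.

(** Expand the product over pairs of moduli m p ^ a and n p ^ b: the conditions modulo m and n
    depend on x alone, and only those modulo powers of p are averaged. *)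
Lemma mean_hits2_le D r1 r2 c (h : nat -> R) x :
  (forall m, m \in D -> (m %| M)%N) ->
  (forall t, 0 <= h t <= c) -> mean T h = 1 ->
  mean T (fun t => h t * (hits (extend p e D) r1 (x + M * t) *
                          hits (extend p e D) r2 (x + M * t))) <=
  \sum_(a <- iota 0 e.+1) \sum_(b <- iota 0 e.+1) pair_weight c p a b *
    (hits D (fun m => r1 (m * p ^ a)%N) x * hits D (fun m => r2 (m * p ^ b)%N) x).
Proof.
move=> DM hc h1.
pose F a b m n t := inclass x (r1 (m * p ^ a)%N) m * inclass x (r2 (n * p ^ b)%N) n *
  (h t * (inclass (x + M * t) (r1 (m * p ^ a)%N) (p ^ a) *
          inclass (x + M * t) (r2 (n * p ^ b)%N) (p ^ b))).
apply: (@le_trans _ _ (mean T (fun t => \sum_(a <- iota 0 e.+1) \sum_(b <- iota 0 e.+1)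
    \sum_(m <- D) \sum_(n <- D) F a b m n t))).
  apply: mean_le => t _; have /andP[h0 _] := hc t.
  apply: (le_trans (ler_wpM2l h0 (ler_pM (hits_ge0 _ _ _) (hits_ge0 _ _ _)
    (hits_extend_le r1 x t DM) (hits_extend_le r2 x t DM)))).
  rewrite mulr_suml mulr_sumr; apply: ler_sum => a _.
  rewrite mulr_sumr mulr_sumr; apply: ler_sum => b _.
  rewrite mulr_suml mulr_sumr; apply: ler_sum => m _.
  rewrite mulr_sumr mulr_sumr; apply: ler_sum => n _.
  by rewrite /F [leRHS]mulrCA [X in _ <= _ * X]mulrACA.
rewrite mean_sum big_seq [leRHS]big_seq; apply: ler_sum => a.
rewrite mem_iota ltnS => /andP[_ ae].
rewrite mean_sum big_seq [leRHS]big_seq; apply: ler_sum => b.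
rewrite mem_iota ltnS => /andP[_ be].
rewrite mean_sum mulr_suml mulr_sumr; apply: ler_sum => m _.
rewrite mean_sum !mulr_sumr; apply: ler_sum => n _.
rewrite /F meanZ mulrC ler_wpM2r ?mulr_ge0 ?inclass_ge0//.
exact: mean_pair_le.
Qed.

(** Restricting the class of m p ^ a to modulus m gives a residue choice on [D] that varies with a.
    Hence the moment hypothesis must hold for all pairs [r1], [r2], not for a single choice. *)
Lemma second_moment_extend D c (w h : nat -> R) f :
  (forall m, m \in D -> (m %| M)%N) ->
  (forall x, 0 <= w x) -> (forall x, 0 <= h x <= c) ->
  (forall x, (x < M)%N -> mean T (fun t => h (x + M * t)%N) = 1) ->
  (forall r1 r2, mean M (fun x => w x * (hits D r1 x * hits D r2 x)) <= f) ->
  forall r1 r2,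
  mean (M * T) (fun x => w (x %% M)%N * h x *
     (hits (extend p e D) r1 x * hits (extend p e D) r2 x)) <=
  f * \sum_(a <- iota 0 e.+1) \sum_(b <- iota 0 e.+1) pair_weight c p a b.
Proof.
move=> DM w0 hc h1 Hf r1 r2.
pose X a b x := hits D (fun m => r1 (m * p ^ a)%N) x * hits D (fun m => r2 (m * p ^ b)%N) x.
have c0 : 0 <= c by have /andP[h0 /(le_trans h0)] := hc 0%N.
rewrite mean_fiber; apply: (@le_trans _ _ (mean M (fun x =>
  \sum_(a <- iota 0 e.+1) \sum_(b <- iota 0 e.+1) pair_weight c p a b * (w x * X a b x)))).
  apply: mean_le => x xM.
  apply: le_trans (le_trans _ (ler_wpM2l (w0 x) (mean_hits2_le r1 r2 x DM
    (fun t => hc (x + M * t)%N) (h1 x xM)))) _.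
    rewrite -meanZ le_eqVlt; apply/orP; left; apply/eqP/eq_mean => t _.
    by rewrite -mulrA [in w _]addnC [in w _]mulnC modnMDl modn_small.
  rewrite mulr_sumr; apply: ler_sum => a _.
  by rewrite mulr_sumr; apply: ler_sum => b _; rewrite mulrCA.
rewrite mean_sum mulr_sumr; apply: ler_sum => a _.
rewrite mean_sum mulr_sumr; apply: ler_sum => b _.
rewrite meanZ mulrC ler_wpM2r//; last exact: Hf.
by rewrite /pair_weight; case: ifP => // _; rewrite divr_ge0.
Qed.

(** Union bound over the fresh moduli: given x in the class modulo m, the condition modulo p ^ a
    holds on a proportion at most p ^ -a of the fiber. *)
Lemma mean_fresh_le D S r x : (forall m, m \in D -> (m %| M)%N) ->
  mean T (fun t => (covered S r (fresh p e D) (x + M * t))%:R) <=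
  \sum_(a <- iota 1 e) (p ^ a)%:R^-1 * hits D (fun m => r (m * p ^ a)%N) x.
Proof.
move=> DM.
apply: (@le_trans _ _ (mean T (fun t => \sum_(a <- iota 1 e) \sum_(m <- D)
   inclass x (r (m * p ^ a)%N) m * inclass (x + M * t) (r (m * p ^ a)%N) (p ^ a)))).
  apply: mean_le => t _; rewrite /covered.
  have [/hasP[_ /allpairsP[[a m]/= [ae mD ->]]]|_] := boolP (has _ _); last first.
    by rewrite sumr_ge0// => a _; rewrite sumr_ge0// => m _; rewrite mulr_ge0 ?inclass_ge0.
  move=> /andP[_ xr]; rewrite (big_rem a)//= ler_wpDr//.
    by rewrite sumr_ge0// => b _; rewrite sumr_ge0// => n _; rewrite mulr_ge0 ?inclass_ge0.
  rewrite (big_rem m)//= ler_wpDr//.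
    by rewrite sumr_ge0// => n _; rewrite mulr_ge0 ?inclass_ge0.
  have <- : inclass (x + M * t) (r (m * p ^ a)%N) m = inclass x (r (m * p ^ a)%N) m :> R.
    by rewrite inclassDr// dvdn_mulr// DM.
  by apply: le_trans (inclassM_le _ _ _ _); rewrite /inclass xr.
rewrite mean_sum big_seq [leRHS]big_seq; apply: ler_sum => a.
rewrite mem_iota => /andP[_ ae].
rewrite mean_sum mulr_sumr; apply: ler_sum => m _.
rewrite meanZ mulrC ler_wpM2r ?inclass_ge0// mean_inclass_pow_le//.
Qed.

Lemma mean_fresh2_le D S r (w : nat -> R) f :
  (forall m, m \in D -> (m %| M)%N) -> (forall x, 0 <= w x) ->
  (forall r1 r2, mean M (fun x => w x * (hits D r1 x * hits D r2 x)) <= f) ->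
  mean M (fun x => w x *
     mean T (fun t => (covered S r (fresh p e D) (x + M * t))%:R) ^+ 2) <=
  f * (\sum_(a <- iota 1 e) (p ^ a)%:R^-1) ^+ 2.
Proof.
move=> DM w0 Hf.
pose H a x := hits D (fun m => r (m * p ^ a)%N) x.
apply: (@le_trans _ _ (mean M (fun x => \sum_(a <- iota 1 e) \sum_(b <- iota 1 e)
    (p ^ a)%:R^-1 * (p ^ b)%:R^-1 * (w x * (H a x * H b x))))).
  apply: mean_le => x _; rewrite expr2.
  have B := mean_fresh_le S r x DM.
  have B0 : 0 <= mean T (fun t => (covered S r (fresh p e D) (x + M * t))%:R) :> R.
    by rewrite divr_ge0// sumr_ge0.
  apply: (le_trans (ler_wpM2l (w0 x) (ler_pM B0 B0 B B))).
  rewrite mulr_suml mulr_sumr; apply: ler_sum => a _.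
  rewrite mulr_sumr mulr_sumr; apply: ler_sum => b _.
  by rewrite [leRHS]mulrCA [X in _ <= _ * X]mulrACA.
rewrite mean_sum expr2 mulr_suml mulr_sumr; apply: ler_sum => a _.
rewrite mean_sum !mulr_sumr; apply: ler_sum => b _.
by rewrite meanZ mulrC ler_wpM2r ?mulr_ge0 ?invr_ge0//; exact: Hf.
Qed.

End SecondMoment.

(** * Exposing one prime: constants and the new density *)

Section Induction.
Context {R : realFieldType}.

(** The factor 10/9 is 1 / (1 - delta) for delta = 1/10, and the fraction is the sum of p ^ -(max a
    b) over all pairs (a, b) other than (0, 0). *)
Definition moment_factor (p : nat) : R :=
  1 + 10 / 9 * ((3 * p%:R - 1) / (p%:R - 1) ^+ 2).

(** Exactly 2 n + 1 pairs have maximum n; the subtracted term is the tail of the series beyond e.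
    The induction adds the layer of maximum e + 1. *)
Lemma sum_pair_weight (c : R) (p e : nat) : (1 < p)%N ->
  \sum_(a <- iota 0 e.+1) \sum_(b <- iota 0 e.+1) pair_weight c p a b =
  1 + c * ((3 * p%:R - 1) / (p%:R - 1) ^+ 2 -
    (2 * e%:R / (p%:R - 1) + (3 * p%:R - 1) / (p%:R - 1) ^+ 2) / p%:R ^+ e).
Proof.
move=> p1; have pR : 1 < p%:R :> R by rewrite ltr1n.
have p10 : p%:R - 1 != 0 :> R by rewrite subr_eq0 gt_eqF.
have p0 : p%:R != 0 :> R by rewrite gt_eqF// (lt_trans ltr01).
elim: e => [|e IH]; first by rewrite !big_seq1 /pair_weight /=; field.
have E F : \sum_(a <- iota 0 e.+2) F a = \sum_(a <- iota 0 e.+1) F a + F e.+1 :> R.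
  by rewrite -[e.+2]addn1 iotaD big_cat big_seq1.
have W (a b : nat) : maxn a b = e.+1 -> pair_weight c p a b = c / p%:R ^+ e.+1.
  rewrite /pair_weight natrX => ab; case: ifPn => [/andP[/eqP a0 /eqP b0]|_].
    by rewrite a0 b0 in ab.
  by rewrite ab.
rewrite E (eq_bigr _ (fun a _ => E _)) big_split IH E W ?maxnn//.
rewrite (eq_big_seq (fun=> c / p%:R ^+ e.+1)); last first.
  by move=> a; rewrite mem_iota => /andP[_ ae]; apply/W/maxn_idPr/ltnW.
rewrite [X in _ + (X + _)](eq_big_seq (fun=> c / p%:R ^+ e.+1)); last first.
  by move=> a; rewrite mem_iota => /andP[_ ae]; apply/W/maxn_idPl/ltnW.
rewrite big_const_seq count_predT size_iota iter_addr_0 /=.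
rewrite -[_ *+ e.+1]mulr_natr [_ ^+ e.+1]exprS -[e.+1%:R]natr1.
have pe0 : p%:R ^+ e != 0 :> R by rewrite expf_neq0.
by field; rewrite p0 p10 pe0.
Qed.

Lemma sum_pair_weight_le (p e : nat) : (1 < p)%N ->
  \sum_(a <- iota 0 e.+1) \sum_(b <- iota 0 e.+1) pair_weight (10 / 9) p a b <=
  moment_factor p.
Proof.
move=> p1; rewrite sum_pair_weight// lerD2l ler_wpM2l ?divr_ge0//.
have pR : 1 < p%:R :> R by rewrite ltr1n.
rewrite gerBl divr_ge0 ?exprn_ge0// addr_ge0// divr_ge0 ?mulr_ge0 ?exprn_ge0//; lra.
Qed.

Lemma sum_geometric_le (p e : nat) : (1 < p)%N ->
  \sum_(a <- iota 1 e) (p ^ a)%:R^-1 <= (p%:R - 1)^-1 :> R.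
Proof.
move=> p1; have pR : 1 < p%:R :> R by rewrite ltr1n.
have p10 : p%:R - 1 != 0 :> R by rewrite subr_eq0 gt_eqF.
have p0 : p%:R != 0 :> R by rewrite gt_eqF// (lt_trans ltr01).
have -> : \sum_(a <- iota 1 e) (p ^ a)%:R^-1 = (1 - (p%:R ^+ e)^-1) / (p%:R - 1) :> R.
  elim: e => [|e IH]; first by rewrite big_nil expr0 invr1 subrr mul0r.
  rewrite -[e.+1]addn1 iotaD big_cat big_seq1 IH add1n addn1 natrX exprS /=.
  have pe0 : p%:R ^+ e != 0 :> R by rewrite expf_neq0.
  by field; rewrite p0 p10 pe0.
have pe : 0 <= (p%:R ^+ e)^-1 :> R by rewrite invr_ge0 exprn_ge0.
by rewrite ler_piMl ?invr_ge0//; lra.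
Qed.

(* w is a density on [0, M) with respect to the uniform measure. *)
Record controlled (S : pred nat) (r : nat -> nat) (M : nat) (D : seq nat) (f b : R)
    (w : nat -> R) : Prop := Controlled {
  controlled_ge0 : forall x, 0 <= w x;
  controlled_mean : mean M w = 1;
  controlled_moment : forall r1 r2,
    mean M (fun x => w x * (hits D r1 x * hits D r2 x)) <= f;
  controlled_covered : mean M (fun x => w x * (covered S r D x)%:R) <= b }.

(** The new density is the old one times a distortion with d = 1/10 on each fiber. The coefficient
    25/9 is 1 / (4 d (1 - d)), and f / (p - 1) ^ 2 bounds the second moment of the bad
    proportion. *)
Lemma controlled_extend S r (p e M : nat) (D : seq nat) f b w : prime p -> coprime p M ->
  (forall m, m \in D -> (m %| M)%N) ->
  controlled S r M D f b w ->
  exists w', controlled S r (M * p ^ e) (extend p e D) (f * moment_factor p)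
    (b + 25 / 9 * (f / (p%:R - 1) ^+ 2)) w'.
Proof.
move=> p_pr copM DM [w0 w1 wf wb]; have p1 := prime_gt1 p_pr.
have d01 : 0 < (10^-1 : R) < 1 by apply/andP; split; lra.
have T0 : (0 < p ^ e)%N by rewrite expn_gt0 ltnW.
set T := (p ^ e)%N in T0 *.
pose B x t := covered S r (fresh p e D) (x + M * t).
pose h y : R := distort T (B (y %% M)%N) 10^-1 (y %/ M).
have hE x t : (x < M)%N -> h (x + M * t)%N = distort T (B x) 10^-1 t.
  move=> xM; have M0 := leq_ltn_trans (leq0n x) xM.
  by rewrite /h addnC mulnC modnMDl divnMDl// modn_small// divn_small// addn0.
have h0 x : 0 <= h x <= 10 / 9.
  rewrite distort_ge0//= (le_trans (distort_le _ _ _ d01))//.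
  rewrite le_eqVlt; apply/orP; left; apply/eqP; by field.
have h1 x : (x < M)%N -> mean T (fun t => h (x + M * t)%N) = 1.
  by move=> xM; rewrite -(mean_distort (B x) T0 d01); apply: eq_mean => t _; rewrite hE.
(* [f] dominates the second moment for any one residue choice, which is nonnegative. *)
have f0 : 0 <= f.
  apply: le_trans (wf (fun=> 0%N) (fun=> 0%N)).
  by rewrite divr_ge0// sumr_ge0// => x _; rewrite !mulr_ge0 ?hits_ge0.
have modE x t : (x < M)%N -> ((x + M * t) %% M = x)%N.
  by move=> xM; rewrite addnC mulnC modnMDl modn_small.
exists (fun x => w (x %% M)%N * h x); split.
- by move=> x; rewrite mulr_ge0//; have /andP[] := h0 x.
- rewrite mean_fiber -w1; apply: eq_mean => x xM.
  rewrite -[RHS]mulr1 -(h1 x xM) -meanZ; apply: eq_mean => t _.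
  by rewrite modE.
- move=> r1 r2; apply: le_trans (second_moment_extend p_pr copM DM w0 h0 h1 wf r1 r2) _.
  by rewrite ler_wpM2l// sum_pair_weight_le.
(* Being covered by an old modulus depends on x alone and [h] has mean 1 on the fiber, so the old
   covered mass is unchanged; the fresh classes add the bad mass. *)
- apply: (@le_trans _ _ (mean M (fun x => w x * (covered S r D x)%:R) +
     25 / 9 * mean M (fun x => w x * mean T (fun t => (B x t)%:R) ^+ 2))); last first.
    apply: lerD => //; rewrite ler_wpM2l ?divr_ge0//.
    have := @mean_fresh2_le _ p e M p_pr copM D S r w f DM w0 wf.
    move=> /le_trans; apply.
    rewrite ler_wpM2l// -exprVn lerXn2r ?nnegrE ?sum_geometric_le// ?sumr_ge0//.
    by rewrite invr_ge0 subr_ge0 ler1n ltnW.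
  rewrite -meanZ -meanD mean_fiber; apply: mean_le => x xM.
  rewrite mulrCA -mulrDr.
  rewrite (eq_mean (g := fun t => w x * (h (x + M * t)%N *
      (covered S r (extend p e D) (x + M * t))%:R))); last first.
    by move=> t _; rewrite modE// mulrA.
  rewrite meanZ ler_wpM2l//.
  apply: (@le_trans _ _ (mean T (fun t => (covered S r D x)%:R * h (x + M * t)%N +
      distort T (B x) 10^-1 t * (B x t)%:R))).
    apply: mean_le => t _; have /andP[h0' _] := h0 (x + M * t)%N.
    rewrite -hE// [X in _ <= X + _]mulrC -mulrDr ler_wpM2l//.
    have -> : covered S r D x = covered S r D (x + M * t).
      apply: eq_in_has => m mD; congr (_ && (_ == _)).
      by rewrite -modnDmr (eqP (dvdn_mulr t (DM m mD))) addn0.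
    by rewrite extend_cat /covered has_cat /B /covered; do 2 case: has => /=; lra.
  rewrite meanD meanZ h1// mulr1 lerD2l.
  apply: le_trans (mean_distort_bad _ _ d01) _.
  by rewrite le_eqVlt; apply/orP; left; apply/eqP; by field.
Qed.

End Induction.

(** * Smooth moduli with bounded exponents *)

Definition modulus (e i : nat) : nat := (\prod_(0 <= p < i | prime p) p ^ e)%N.

(** The divisors of [modulus e i], generated prime by prime in step with the exposure; the cap [e]
    on exponents keeps the list finite. *)
Fixpoint smooth (e i : nat) : seq nat :=
  if i is j.+1 then if prime j then extend j e (smooth e j) else smooth e j
  else [:: 1%N].

Lemma modulusS e i :
  modulus e i.+1 = if prime i then (modulus e i * i ^ e)%N else modulus e i.
Proof.
rewrite /modulus big_mkcond big_nat_recr//= -big_mkcond/=.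
by case: ifP; rewrite ?muln1.
Qed.

Lemma modulus_gt0 e i : (0 < modulus e i)%N.
Proof. by apply: prodn_cond_gt0 => p /prime_gt0 p0; rewrite expn_gt0 p0. Qed.

Lemma coprime_modulus e i j : prime i -> (j <= i)%N -> coprime i (modulus e j).
Proof.
move=> i_pr; elim: j => [_|j IH ji]; first by rewrite /modulus big_geq ?coprimen1.
rewrite modulusS; case: ifP => [j_pr|_]; last by rewrite IH// ltnW.
rewrite coprimeMr (IH (ltnW ji)) /=; apply: coprimeXr.
by rewrite (prime_coprime _ i_pr) (dvdn_prime2 i_pr j_pr) neq_ltn ji orbT.
Qed.

Lemma smooth_dvd e i m : m \in smooth e i -> (m %| modulus e i)%N.
Proof.
elim: i m => [|i IH] m /=; first by rewrite inE => /eqP ->; rewrite dvd1n.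
rewrite modulusS; case: ifP => _; last exact: IH.
move=> /allpairsP[[a n] [ae nD ->]]; apply: dvdn_mul; first exact: IH.
by apply: dvdn_exp2l; move: ae; rewrite mem_iota ltnS => /andP[].
Qed.

Lemma mem_smooth e i n : (0 < n)%N ->
  (forall p, prime p -> (p %| n)%N -> (p < i)%N) ->
  (forall p, (logn p n <= e)%N) -> n \in smooth e i.
Proof.
elim: i n => [|i IH] n n0 np nl /=.
  rewrite inE; apply: contraT => n1; have := np _ (pdiv_prime _) (pdiv_dvd n).
  by rewrite ltn0 => ->//; rewrite ltn_neqAle eq_sym n1.
case: ifPn => [i_pr|i_npr]; last first.
  apply: IH => // p p_pr pn; have := np p p_pr pn.
  by rewrite ltnS leq_eqVlt => /orP[/eqP pi|//]; rewrite pi (negPf i_npr) in p_pr.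
have [m im nE] := pfactor_coprime i_pr n0.
apply/allpairsP; exists (logn i n, m); split=> //.
  by rewrite mem_iota ltnS nl.
have mn : (m %| n)%N by rewrite nE dvdn_mulr.
apply: IH => [|p p_pr pm|p]; first exact: dvdn_gt0 mn.
- have := np p p_pr (dvdn_trans pm mn).
  rewrite ltnS leq_eqVlt => /orP[/eqP pi|//].
  by move: im; rewrite prime_coprime// -pi pm.
- exact: leq_trans (dvdn_leq_log p n0 mn) (nl p).
Qed.

(** * Running through all primes, uniformly below the cutoff and distorted above it *)

Section Uncovered.
Context {R : realFieldType}.

Definition moment_bound (i : nat) : R :=
  \prod_(0 <= p < i | prime p) moment_factor p.

Lemma moment_boundS i :
  moment_bound i.+1 =
  if prime i then moment_bound i * moment_factor i else moment_bound i.
Proof.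
rewrite /moment_bound big_mkcond big_nat_recr//= -big_mkcond/=.
by case: ifP; rewrite ?mulr1.
Qed.

(** The uniform density is the case w = h = 1, and 1 <= 10/9, so undistorted primes obey the same
    moment factors. *)
Lemma mean_hits2_uniform e i r1 r2 :
  mean (modulus e i) (fun x => hits (smooth e i) r1 x * hits (smooth e i) r2 x)
    <= moment_bound i.
Proof.
elim: i r1 r2 => [|i IH] r1 r2.
  rewrite /modulus /moment_bound !big_geq// /mean big_ord1 divr1.
  by rewrite /hits !big_seq1 !inclass1 mulr1.
rewrite modulusS moment_boundS /=; case: ifP => // i_pr.
have M0 := modulus_gt0 e i.
have T0 : (0 < i ^ e)%N by rewrite expn_gt0 prime_gt0.
have c1 (x : nat) : 0 <= (1 : R) <= 10 / 9 by apply/andP; split; lra.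
have IH' s1 s2 : mean (modulus e i) (fun x => 1 * (hits (smooth e i) s1 x *
    hits (smooth e i) s2 x)) <= moment_bound i by rewrite meanZ mul1r.
have := second_moment_extend i_pr (coprime_modulus e i_pr (leqnn i)) (@smooth_dvd e i)
  (fun=> ler01) c1 (fun _ _ => mean1 T0) IH' r1 r2.
rewrite !mul1r meanZ mul1r => /le_trans; apply.
rewrite ler_wpM2l ?sum_pair_weight_le ?prime_gt1//.
apply: le_trans (IH (fun=> 0%N) (fun=> 0%N)).
by rewrite divr_ge0// sumr_ge0// => x _; rewrite !mulr_ge0 ?hits_ge0.
Qed.

(** Union bound: under the uniform measure a class modulo n has mass at most 1/n. *)
Lemma controlled_smooth S r e K (b : R) :
  \sum_(n <- smooth e K | S n) n%:R^-1 <= b ->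
  controlled S r (modulus e K) (smooth e K) (moment_bound K) b (fun=> 1).
Proof.
move=> Hb; have M0 := modulus_gt0 e K; split=> // [|r1 r2|]; first exact: mean1.
  by under eq_mean do rewrite mul1r; exact: mean_hits2_uniform.
under eq_mean do rewrite mul1r; apply: le_trans Hb.
apply: (@le_trans _ _ (mean (modulus e K) (fun x =>
    \sum_(n <- smooth e K | S n) inclass x (r n) n))).
  apply: mean_le => x _; rewrite /covered.
  have [/hasP[n nD /andP[Sn xn]]|_] := boolP (has _ _); last first.
    by rewrite sumr_ge0// => n _; rewrite inclass_ge0.
  by rewrite (big_rem n)//= Sn {1}/inclass xn lerDl sumr_ge0//.
rewrite mean_sum big_seq_cond [leRHS]big_seq_cond; apply: ler_sum => n /andP[nD _].
have nM := smooth_dvd nD; have n0 := dvdn_gt0 M0 nM.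
have := @mean_inclass_le R 1 0 (r n) n (modulus e K %/ n) n0 _ (coprimen1 n).
rewrite divn_gt0// dvdn_leq// => /(_ isT).
rewrite muln_divCA// divnn n0 muln1; apply: le_trans.
by apply: mean_le => x _; rewrite add0n mul1n.
Qed.

Lemma controlled_iter S r e K P (b : R) : (K <= P)%N ->
  \sum_(n <- smooth e K | S n) n%:R^-1 <= b ->
  exists w, controlled S r (modulus e P) (smooth e P) (moment_bound P)
    (b + 25 / 9 * \sum_(K <= p < P | prime p) moment_bound p / (p%:R - 1) ^+ 2) w.
Proof.
move=> + Hb; elim: P => [|P IH].
  rewrite leqn0 => /eqP K0; exists (fun=> 1).
  by rewrite big_geq// mulr0 addr0 -K0; apply: controlled_smooth.
rewrite leq_eqVlt => /orP[/eqP KP|].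
  exists (fun=> 1); rewrite -KP big_geq// mulr0 addr0; exact: controlled_smooth.
rewrite ltnS => KP; have [w Hw] := IH KP.
rewrite big_mkcond big_nat_recr//= -big_mkcond/=.
rewrite modulusS moment_boundS; case: ifP => [P_pr|_]; last by exists w; rewrite addr0.
have [|m mD|w' Hw'] := controlled_extend e P_pr _ _ Hw.
- exact: coprime_modulus.
- exact: smooth_dvd.
- by exists w'; rewrite [25 / 9 * (_ + _)]mulrDr addrA.
Qed.

(** If everything were covered, the covered mass would be the total mass 1 of the density. *)
Lemma exists_uncovered (S : pred nat) r e K P (b : R) : (K <= P)%N ->
  \sum_(n <- smooth e K | S n) n%:R^-1 <= b ->
  b + 25 / 9 * \sum_(K <= p < P | prime p) moment_bound p / (p%:R - 1) ^+ 2 < 1 ->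
  exists x, ~~ covered S r (smooth e P) x.
Proof.
move=> KP Hb lt1; have [w [w0 w1 _ wb]] := controlled_iter r KP Hb.
have [/forallP H|/forallPn[x Hx]] :=
  boolP [forall x : 'I_(modulus e P), covered S r (smooth e P) x]; last by exists x.
have := le_lt_trans wb lt1.
rewrite (eq_mean (g := w)) ?w1 ?ltxx// => x xM.
by rewrite (H (Ordinal xM)) mulr1.
Qed.

End Uncovered.

(** * Numerical estimates: reciprocals of smooth numbers *)

Section Numerics.
Context {R : realType}.

(* Rankin's trick: 1/n <= 1 / (sqrt N * sqrt n) for n >= N. *)
Lemma sum_sqrt_smooth e i :
  \sum_(n <- smooth e i) (Num.sqrt n%:R)^-1 <= 4 ^+ i :> R.
Proof.
elim: i => [|i IH] /=; first by rewrite big_seq1 sqrtr1 invr1 expr0.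
have s0 (n : nat) : 0 <= (Num.sqrt n%:R)^-1 :> R by rewrite invr_ge0 sqrtr_ge0.
case: ifP => [i_pr|_]; last first.
  by apply: le_trans IH _; rewrite exprS ler_peMl ?exprn_ge0//; lra.
rewrite big_allpairs_dep exchange_big/=.
(* The ratio is at most 1 / sqrt 2 <= 3/4, so the geometric series is at most 4. *)
have geo : \sum_(a <- iota 0 e.+1) (Num.sqrt (i%:R : R))^-1 ^+ a <= 4.
  set x := (Num.sqrt i%:R)^-1; have x0 : 0 <= x by exact: s0.
  have x34 : x <= 3 / 4.
    have i2 : (2 : R) <= i%:R by rewrite ler_nat prime_gt1.
    have i43 : 4 / 3 <= Num.sqrt (i%:R : R).
      rewrite -[4 / 3]ger0_norm -?sqrtr_sqr; last lra.
      by apply: ler_wsqrtr; lra.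
    rewrite (_ : 3 / 4 = (4 / 3)^-1); last by field.
    by rewrite lef_pV2 ?posrE //; lra.
  suff : (1 - x) * \sum_(a <- iota 0 e.+1) x ^+ a <= 1.
    have S0 : 0 <= \sum_(a <- iota 0 e.+1) x ^+ a.
      by apply: sumr_ge0 => a _; rewrite exprn_ge0.
    have := ler_wpM2r S0 (_ : 1 / 4 <= 1 - x); nra.
  have -> : \sum_(a <- iota 0 e.+1) x ^+ a = \sum_(a < e.+1) x ^+ a.
    by rewrite -(big_mkord xpredT (fun a => x ^+ a)) /index_iota subn0.
  by rewrite -opprB mulNr -subrX1 opprB gerBl exprn_ge0.
have -> : \sum_(m <- smooth e i) \sum_(a <- iota 0 e.+1) (Num.sqrt (m * i ^ a)%:R)^-1 =
   (\sum_(m <- smooth e i) (Num.sqrt (m%:R : R))^-1) *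
   \sum_(a <- iota 0 e.+1) (Num.sqrt (i%:R : R))^-1 ^+ a.
  rewrite mulr_suml; apply: eq_bigr => m _; rewrite mulr_sumr; apply: eq_bigr => a _.
  rewrite natrM natrX sqrtrM// invfM; congr (_ * _); rewrite exprVn; congr _^-1.
  elim: a => [|a IHa]; first by rewrite !expr0 sqrtr1.
  by rewrite !exprS sqrtrM// IHa.
rewrite exprS mulrC; apply: ler_pM => //; exact: sumr_ge0.
Qed.

Lemma smooth_tail (K : nat) : exists N : nat, (0 < N)%N /\
  forall e (S : pred nat), (forall n, S n -> (N <= n)%N) ->
  \sum_(n <- smooth e K | S n) n%:R^-1 <= (1 / 4 : R).
Proof.
(* The square root of this N is 4 ^ (K + 1), four times the bound 4 ^ K of [sum_sqrt_smooth]. *)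
exists ((4 ^ K.+1) ^ 2)%N; split; first by rewrite !expn_gt0.
move=> e S SN; have c0 : 0 < (4 : R) ^+ K.+1 by rewrite exprn_gt0.
apply: (@le_trans _ _ (\sum_(n <- smooth e K) (4 ^+ K.+1)^-1 * (Num.sqrt (n%:R : R))^-1)).
  rewrite big_mkcond; apply: ler_sum => n _; case: ifP => [Sn|_]; last first.
    by rewrite mulr_ge0 ?invr_ge0 ?sqrtr_ge0// ltW.
  have n0 : (0 : R) < n%:R.
    by rewrite ltr0n (leq_trans _ (SN n Sn))// !expn_gt0.
  have -> : n%:R^-1 = (Num.sqrt n%:R)^-1 * (Num.sqrt n%:R)^-1 :> R.
    by rewrite -invfM -expr2 sqr_sqrtr// ltW.
  rewrite ler_wpM2r ?invr_ge0 ?sqrtr_ge0//.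
  rewrite lef_pV2 ?posrE ?sqrtr_gt0//.
  rewrite -[4 ^+ K.+1]ger0_norm -?sqrtr_sqr ?(ltW c0)//.
  by apply: ler_wsqrtr; rewrite -!natrX ler_nat SN.
rewrite -mulr_sumr -ler_pdivlMl ?invr_gt0// invrK.
apply: le_trans (sum_sqrt_smooth e K) _.
by rewrite exprS; have := exprn_ge0 K (_ : 0 <= (4 : R)); lra.
Qed.

(** * Growth of the moment bound and the sum over large primes *)

Lemma moment_factor_ge1 p : (0 < p)%N -> 1 <= moment_factor p :> R.
Proof.
move=> p0; have : (1 : R) <= p%:R by rewrite ler1n.
by rewrite /moment_factor lerDl => ?; rewrite mulr_ge0 ?divr_ge0 ?sqr_ge0//; lra.
Qed.

Lemma moment_bound_ge1 i : 1 <= moment_bound i :> R.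
Proof.
elim: i => [|i IH]; first by rewrite /moment_bound big_geq.
rewrite moment_boundS; case: ifP => // /prime_gt0 /moment_factor_ge1 H.
by rewrite -[1]mulr1 ler_pM.
Qed.

Lemma moment_bound_le i j : (i <= j)%N -> moment_bound i <= moment_bound j :> R.
Proof.
elim: j => [|j IH]; first by rewrite leqn0 => /eqP ->.
rewrite leq_eqVlt => /orP[/eqP ->//|]; rewrite ltnS => /IH H.
rewrite moment_boundS; case: ifP => // /prime_gt0 /moment_factor_ge1 Hf.
have := moment_bound_ge1 j => H1.
by rewrite (le_trans H)// ler_peMr//; lra.
Qed.

(** To leading order the increment is 10/9 * 3/p <= (1/9) / q; 0.114 leaves room for lower-order
    terms once p >= 3000. *)
Lemma moment_factor_le p q : (100 <= q)%N -> (30 * q <= p)%N ->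
  moment_factor p <= 1 + 114 / 1000 / q%:R :> R.
Proof.
move=> q100 qp; rewrite /moment_factor lerD2l.
have qR : (100 : R) <= q%:R by rewrite ler_nat.
have pR : 30 * q%:R <= p%:R :> R by rewrite -natrM ler_nat.
rewrite mulrA ler_pdivrMr ; last by rewrite exprn_gt0; lra.
rewrite [leRHS]mulrAC ler_pdivlMr; last lra.
have : 0 <= (p%:R - 30 * q%:R) * (3 * p%:R - 1) :> R by rewrite mulr_ge0; lra.
have : 0 <= p%:R * (p%:R - 3000) :> R by rewrite mulr_ge0; lra.
by rewrite expr2; lra.
Qed.

(* Among 30 consecutive integers, 8 are coprime to 30. *)
Lemma moment_bound_block q : (100 <= q)%N ->
  moment_bound (30 * q.+1) <= (1 + 95 / 100 / q%:R) * moment_bound (30 * q) :> R.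
Proof.
move=> q100; set m : R := 1 + 114 / 1000 / q%:R.
have qR : (100 : R) <= q%:R by rewrite ler_nat.
have m1 : 1 <= m by rewrite lerDl; apply: divr_ge0; lra.
rewrite {1}/moment_bound (@big_cat_nat _ _ _ (30 * q))//=; last by rewrite leq_mul2l leqnSn.
rewrite mulrC ler_wpM2r//.
  exact: le_trans ler01 (moment_bound_ge1 (30 * q)).
apply: (@le_trans _ _ (\prod_(30 * q <= p < 30 * q.+1 | coprime p 30) m)).
  rewrite big_mkcond [leRHS]big_mkcond big_nat_cond [leRHS]big_nat_cond.
  apply: ler_prod => p; rewrite andbT => /andP[qp _].
  case: ifP => [p_pr|_]; last by case: ifP => _; lra.
  have := moment_factor_ge1 (prime_gt0 p_pr); have := moment_factor_le q100 qp.
  rewrite -/m prime_coprime// gtnNdvd//; last by rewrite (leq_trans _ qp)//; lia.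
  by move=> /= mf1 mf2; apply/andP; split; [|exact: mf1]; lra.
have -> : \prod_(30 * q <= p < 30 * q.+1 | coprime p 30) m = m ^+ 8.
  rewrite mulnSr -{1}[(30 * q)%N]add0n big_addn addKn.
  rewrite (eq_bigl (fun i => coprime i 30)); last first.
    by move=> i; rewrite /coprime addnC mulnC gcdnC gcdnMDl gcdnC.
  rewrite big_const_seq.
  have -> : count (fun i => coprime i 30) (index_iota 0 30) = 8%N by [].
  by rewrite iter_mulr_1.
have : 0 < (q%:R^-1 : R) <= 1 / 100.
  by rewrite invr_gt0 (lt_le_trans _ qR)//= div1r lef_pV2 ?posrE; lra.
rewrite /m; move: (q%:R^-1) => y /andP[y0 y1].
(* The eighth power is three squarings. Each slightly more than doubles the linear coefficient to
   absorb the quadratic term, using y <= 1/100. *)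
have sq (a b c : R) : 0 <= a <= 1 + b * y -> (1 + b * y) ^+ 2 <= 1 + c * y ->
    0 <= a ^+ 2 <= 1 + c * y.
  by move=> /andP[a0 ab] H; rewrite sqr_ge0 (le_trans _ H)// lerXn2r ?nnegrE//; lra.
have m0 : 0 <= 1 + 114 / 1000 * y <= 1 + 114 / 1000 * y by apply/andP; split; lra.
have m2 : 0 <= (1 + 114 / 1000 * y) ^+ 2 <= 1 + 230 / 1000 * y by apply: sq m0 _; nra.
have m4 : 0 <= ((1 + 114 / 1000 * y) ^+ 2) ^+ 2 <= 1 + 462 / 1000 * y.
  by apply: sq m2 _; nra.
have : 0 <= (((1 + 114 / 1000 * y) ^+ 2) ^+ 2) ^+ 2 <= 1 + 95 / 100 * y.
  by apply: sq m4 _; nra.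
by rewrite -!exprM => /andP[].
Qed.

(* moment_bound (30 q) grows at most like q ^ (19/20), so this tends to 0. *)
Definition growth (q : nat) : R := moment_bound (30 * q) / q%:R.

Lemma growth_le q : (100 <= q)%N -> growth q.+1 * (q%:R + 1) <= growth q * (q%:R + 95 / 100).
Proof.
move=> q100; have qR : (100 : R) <= q%:R by rewrite ler_nat.
rewrite /growth -natr1 divfK; last by rewrite gt_eqF//; lra.
apply: le_trans (moment_bound_block q100) _.
by rewrite le_eqVlt; apply/orP; left; apply/eqP; field; lra.
Qed.

Lemma growth_gt0 q : (0 < q)%N -> 0 < growth q.
Proof.
by move=> q0; rewrite divr_gt0 ?ltr0n// (lt_le_trans _ (moment_bound_ge1 _)).
Qed.

(** Each step from q to q + 1 shrinks [growth] by (q + 0.95) / (q + 1). For q < 2 n this gains about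
    1 / (40 n), and n steps accumulate 1/40. *)
Lemma growth_double n : (100 <= n)%N -> growth (n * 2) * (41 / 40) <= growth n.
Proof.
move=> n100; have nR : (100 : R) <= n%:R by rewrite ler_nat.
suff H j : (j <= n)%N -> growth (n + j) * (1 + j%:R / (40 * n%:R)) <= growth n.
  have := H n (leqnn n); rewrite addnn -mul2n mulnC.
  have -> : n%:R / (40 * n%:R) = 1 / 40 :> R by field; lra.
  by lra.
elim: j => [_|j IH jn]; first by rewrite addn0 mul0r addr0 mulr1.
apply: le_trans (IH (ltnW jn)); set q := (n + j)%N.
have jR : j%:R + 1 <= n%:R :> R by rewrite natr1 ler_nat.
have qE : q%:R = n%:R + j%:R :> R by rewrite natrD.
have j0 : 0 <= j%:R :> R by [].
have q100 : (100 <= q)%N by rewrite (leq_trans n100) ?leq_addr.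
have Hr := growth_le q100; have uq : 0 < growth q by apply: growth_gt0; lia.
have q1 : 0 < q%:R + 1 :> R by lra.
rewrite addnS -/q -(ler_pM2r q1) mulrAC.
apply: (@le_trans _ _ (growth q * (q%:R + 95 / 100) * (1 + j.+1%:R / (40 * n%:R)))).
  by rewrite ler_wpM2r// addr_ge0// divr_ge0//; lra.
rewrite -[j.+1%:R]natr1 -[leLHS]mulrA -[leRHS]mulrA ler_pM2l// qE.
have : 0 <= (n%:R - j%:R - 1 + 1 / 20 * (j%:R + 1)) / (40 * n%:R) :> R.
  by rewrite divr_ge0//; lra.
have E : (1 + j%:R / (40 * n%:R)) * (n%:R + j%:R + 1) -
   (n%:R + j%:R + 95 / 100) * (1 + (j%:R + 1) / (40 * n%:R)) =
   (n%:R - j%:R - 1 + 1 / 20 * (j%:R + 1)) / (40 * n%:R) :> R by field; lra.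
by rewrite -E subr_ge0.
Qed.

Lemma growth_small (eps : R) : 0 < eps -> exists2 k, (100 <= k)%N & growth k <= eps.
Proof.
move=> eps0; have u100 : 0 < growth 100 by apply: growth_gt0.
have bern k : 1 + k%:R / 40 <= (41 / 40) ^+ k :> R.
  elim: k => [|k IH]; first by rewrite mul0r addr0 expr0.
  rewrite exprS -natr1; have k0 : 0 <= k%:R :> R by [].
  by apply: le_trans (ler_wpM2l _ IH); lra.
have geo k : growth (100 * 2 ^ k) * (41 / 40) ^+ k <= growth 100.
  elim: k => [|k IH]; first by rewrite expn0 muln1 expr0 mulr1.
  apply: le_trans IH; rewrite expnSr mulnA exprS [leLHS]mulrA ler_wpM2r//.
  by apply: growth_double; rewrite leq_pmulr// expn_gt0.
have B0 : 0 <= 40 * (growth 100 / eps) by rewrite mulr_ge0// divr_ge0 ?ltW.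
have [k kB] : exists k, 40 * (growth 100 / eps) < k%:R.
  by exists (Num.bound (40 * (growth 100 / eps))); exact: archi_boundP.
exists (100 * 2 ^ k)%N; first by rewrite leq_pmulr// expn_gt0.
have Bk := bern k; have c0 : 0 < (41 / 40) ^+ k :> R by rewrite exprn_gt0; lra.
rewrite -(ler_pM2r c0); apply: le_trans (geo k) _.
rewrite -ler_pdivrMl// mulrC; lra.
Qed.

(** The block sum is of order growth q / q, and so is the drop of [growth] by the factor (q + 0.95)
    / (q + 1); bounding one by the other makes the sum over blocks telescope. *)
Lemma block_le q : (100 <= q)%N ->
  \sum_(30 * q <= p < 30 * q.+1 | prime p) moment_bound p / (p%:R - 1) ^+ 2 <=
  4 * (growth q - growth q.+1).
Proof.
move=> q100; have qR : (100 : R) <= q%:R by rewrite ler_nat.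
pose g := moment_bound (30 * q) : R.
have g1 : 1 <= g by exact: moment_bound_ge1.
have y0 : 0 < q%:R^-1 :> R by rewrite invr_gt0; lra.
(* Within a block the moment bound at most doubles, and p - 1 >= 30 q - 1 >= 29 q. *)
apply: (@le_trans _ _ (\sum_(30 * q <= p < 30 * q.+1) 2 * g / (29 * q%:R) ^+ 2)).
  rewrite big_mkcond big_nat_cond [leRHS]big_nat_cond; apply: ler_sum => p.
  rewrite andbT => /andP[qp pq].
  have pR : 30 * q%:R <= p%:R :> R by rewrite -natrM ler_nat.
  have rhs0 : 0 <= 2 * g / (29 * q%:R) ^+ 2.
    by rewrite divr_ge0 ?sqr_ge0//; lra.
  case: ifP => // _; apply: ler_pM.
  - exact: le_trans ler01 (moment_bound_ge1 p).
  - by rewrite invr_ge0 sqr_ge0.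
  - apply: le_trans (moment_bound_le (ltnW pq)) _.
    apply: le_trans (moment_bound_block q100) _; rewrite -/g ler_wpM2r//; first lra.
    have : q%:R^-1 <= 1 / 100 :> R by rewrite div1r lef_pV2 ?posrE; lra.
    lra.
  - rewrite lef_pV2 ?posrE ?exprn_gt0 ?lerXn2r ?nnegrE//; lra.
rewrite sumr_const_nat mulnSr addKn.
have := growth_le q100; rewrite {1 2}/growth -/g => H.
have -> : growth q.+1 = growth q.+1 * (q%:R + 1) / (q%:R + 1) by rewrite mulfK//; lra.
have q1 : 0 < (q%:R + 1)^-1 :> R by rewrite invr_gt0; lra.
have {}H := ler_wpM2r (ltW q1) H.
apply: (@le_trans _ _ (4 * (growth q - growth q * (q%:R + 95 / 100) / (q%:R + 1))));
  last by rewrite ler_wpM2l// lerD2l lerN2.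
have -> : 4 * (growth q - growth q * (q%:R + 95 / 100) / (q%:R + 1)) =
    g / (5 * q%:R * (q%:R + 1)).
  by rewrite /growth -/g; field; lra.
have -> : 2 * g / (29 * q%:R) ^+ 2 *+ 30 = g * (60 / (841 * q%:R ^+ 2)).
  by rewrite -mulr_natr; field; lra.
rewrite ler_wpM2l//; first lra.
rewrite ler_pdivrMr; last by apply: mulr_gt0; [|apply: exprn_gt0]; lra.
rewrite ler_pdivlMl; last by apply: mulr_gt0; [apply: mulr_gt0|]; lra.
by nra.
Qed.

Lemma prime_tail (eps : R) : 0 < eps -> exists K, forall P, (K <= P)%N ->
  \sum_(K <= p < P | prime p) moment_bound p / (p%:R - 1) ^+ 2 <= eps.
Proof.
move=> eps0; have [k k100 uk] := @growth_small (eps / 4) ltac:(lra).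
have t0 p : 0 <= moment_bound p / (p%:R - 1) ^+ 2 :> R.
  by rewrite divr_ge0 ?sqr_ge0// (le_trans ler01 (moment_bound_ge1 p)).
have blocks n : (k <= n)%N ->
    \sum_(30 * k <= p < 30 * n | prime p) moment_bound p / (p%:R - 1) ^+ 2 <=
    4 * (growth k - growth n).
  elim: n => [|n IH]; first by rewrite leqn0 => /eqP k0; rewrite k0 in k100.
  rewrite leq_eqVlt => /orP[/eqP <-|]; first by rewrite big_geq// subrr mulr0.
  rewrite ltnS => kn; rewrite (@big_cat_nat _ _ _ (30 * n)) ?leq_mul2l ?leqnSn ?kn//=.
  have := block_le (leq_trans k100 kn); have := IH kn; lra.
exists (30 * k)%N => P kP.
have KP : (k <= P)%N by lia.
have := blocks P KP; have : 0 < growth P by apply: growth_gt0; lia.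
(* The upper limit P is raised to 30 P, a block boundary; the added terms are nonnegative. *)
rewrite (@big_cat_nat _ _ _ P) ?kP//=; last by lia.
have : 0 <= \sum_(P <= i < 30 * P | prime i) moment_bound i / (i%:R - 1) ^+ 2 :> R.
  by rewrite sumr_ge0.
lra.
Qed.
End Numerics.

(** * From an uncovered integer to positive density *)

Lemma exists_uncovered_nat (R : realType) : exists N : nat, (0 < N)%N /\
  forall (S : {fset nat}) (r : nat -> nat), (forall n, n \in S -> (N <= n)%N) ->
  exists x, forall n, n \in S -> x != r n %[mod n].
Proof.
(* With the smooth part at most 1/4, the total is 1/4 + 25/9 * 1/5 = 29/36 < 1. *)
have [K HK] := @prime_tail R (1 / 5) ltac:(lra).
have [N [N0 HN]] := @smooth_tail R K; exists N; split=> // S r SN.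
(* The largest modulus m serves as exponent cap, and P exceeds every prime factor, so all of [S]
   lies in [smooth m P]. *)
pose m := (\max_(n <- S) n)%N; pose P := maxn K m.+1.
have Sm n : n \in S -> (n <= m)%N by move=> nS; rewrite /m (big_rem n)//= leq_maxl.
have KP : (K <= P)%N by rewrite leq_maxl.
have [|x Hx] := exists_uncovered (S := [pred n | n \in S]) r KP (HN m _ SN).
  by have := HK P KP; lra.
exists x => n nS; apply: contra Hx => xr; apply/hasP; exists n; last by rewrite /= nS.
have n0 : (0 < n)%N by exact: leq_trans (SN n nS).
apply: mem_smooth => // [p p_pr pn|p].
  by rewrite leq_max ltnS orbC (leq_trans (dvdn_leq n0 pn) (Sm n nS)).
by apply: leq_trans (Sm n nS); apply: ltnW; apply: ltn_logl.
Qed.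

Lemma exists_uncovered_int (R : realType) : exists N : nat, (0 < N)%N /\
  forall (S : {fset nat}) (r : nat -> int), (forall n, n \in S -> (N <= n)%N) ->
  exists x : nat, uncovered S r x%:Z.
Proof.
have [N [N0 HN]] := exists_uncovered_nat R; exists N; split=> // S r SN.
have [x Hx] := HN S (fun n => `|(r n %% n)%Z|%N) SN; exists x.
apply/allP => n nS; have := Hx n nS; apply: contra => /eqP xr.
by rewrite -xr modz_nat absz_nat modn_mod.
Qed.

Lemma count_upto_gt0 (A : pred int) (L x : nat) : (0 < L)%N ->
  (forall y, A (y + L%:Z) = A y) -> A x%:Z -> (0 < count_upto A L)%N.
Proof.
move=> L0 AL Ax; rewrite lt0n; apply/negP => /eqP C0.
have : count_upto A (x.+1 * L + 0) = 0%N.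
  by rewrite count_uptoMD// C0 muln0 /count_upto big_geq.
(* Counting starts at 1 and x may be 0, so its translate x + L is used. *)
rewrite addn0 /count_upto (bigD1_seq (x + L)%N) ?iota_uniq//=.
  by rewrite PoszD AL Ax.
by rewrite mem_index_iota addn_gt0 L0 orbT ltnS mulSn addnC leq_add2l leq_pmulr.
Qed.

Theorem theoremA (R : realType) (c : R) (hc0 : 0 < c) (hc1 : c < 1 / 3) :
  exists N0 : R, forall N : R, N0 <= N ->
  forall S : {fset nat}, (forall n : nat, n \in S -> N < n%:R) ->
  \sum_(n <- S) 1 / n%:R <= c * (ln N * ln (ln (ln N)) / ln (ln N)) ->
  0 < delta_minus R S.
Proof.
have [N0 [N00 HN]] := exists_uncovered_int R.
exists N0%:R => N leN S SN _.
have SN0 n : n \in S -> (N0 <= n)%N.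
  by move=> /SN lt; rewrite -(ler_nat R) (le_trans leN (ltW lt)).
have S0 n : n \in S -> (0 < n)%N by move=> /SN0; exact: leq_trans.
(* The infimum is attained at some [r], so one uncovered integer for this [r], repeated
   periodically, suffices. *)
have [[r ->] _] := delta_minus_min R S0.
rewrite density_uncovered//; set L := (\big[lcmn/1%N]_(n <- S) n)%N.
have L0 : (0 < L)%N.
  by rewrite /L big_seq; elim/big_ind: _ => // a b a0 b0; rewrite lcmn_gt0 a0.
have [x Hx] := HN S r SN0.
by rewrite divr_gt0 ?ltr0n// (count_upto_gt0 L0 (@uncovered_periodic S r) Hx).
Qed.
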